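(* Let $F$ be a non-reversible Finsler metric on a manifold $M$. Then $$\tilde F(v)=F(v)+F(-v),\qquad \hat F(v)=\sqrt{F(v)^2+F(-v)^2},\qquad v\in TM,$$ are reversible Finsler metrics and $$\mathrm{Iso}(M,F)\subseteq\mathrm{Iso}(M,\tilde F)\cap\mathrm{Iso}(M,\hat F).$$ Moreover, this inclusion becomes an equality for the connected components of the identity of each side.
   Context: A Finsler metric on $M$ is a continuous function $F:TM\to[0,\infty)$, smooth away from the zero section, with $F(v)=0$ iff $v$ is a zero vector, $F(\lambda v)=\lambda F(v)$ for $\lambda>0$, and such that the fundamental tensor $g_v(u,w)=\frac12\frac{\partial^2}{\partial t\partial s}F(v+tu+sw)^2|_{t=s=0}$ is positive definite for every nonzero $v\in TM$. $F$ is reversible if $F(-v)=F(v)$ for all $v\in TM$, and non-reversible otherwise. $\mathrm{Iso}(M,F)$ is the isometry group of $(M,F)$, i.e. the group of diffeomorphisms $\phi:M\to M$ with $F(d\phi(v))=F(v)$ for all $v\in TM$, with its usual topology; similarly for $\tilde F$ and $\hat F$. *)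

(* Defs.v *)
From HB Require Import structures.
From mathcomp Require Import all_boot all_order all_algebra.
From mathcomp Require Import all_classical all_reals all_analysis.

Set Implicit Arguments.
Unset Strict Implicit.
Unset Printing Implicit Defensive.

Import Order.TTheory GRing.Theory Num.Theory.
Import numFieldNormedType.Exports.

Local Open Scope classical_set_scope.
Local Open Scope ring_scope.

(* [C_k k A f]: on the (open) set [A], [f] is differentiable up to order [k]
   and all its iterated directional derivatives up to order [k] are continuous. *)
Fixpoint C_k (R : realType) (V W : normedModType R) (k : nat) (A : set V)
    (f : V -> W) : Prop :=
  match k with
  | 0 => forall x, A x -> {for x, continuous f}
  | k'.+1 => (forall x, A x -> differentiable f x) /\
             (forall v : V, C_k k' A (fun x => 'D_v f x))
  end.

Definition smooth_on (R : realType) (V W : normedModType R) (A : set V)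
    (f : V -> W) : Prop := forall k, C_k k A f.

(* A homeomorphism between an open subset of [M] and an open subset of R^n;
   [chart_map] and [chart_inv] are unconstrained outside these subsets. *)
Record chart (R : realType) (n : nat) (M : topologicalType) := Chart {
  chart_dom : set M;
  chart_cod : set 'rV[R]_n;
  chart_map :> M -> 'rV[R]_n;
  chart_inv : 'rV[R]_n -> M;
  chart_dom_open : open chart_dom;
  chart_cod_open : open chart_cod;
  chart_map_cod : forall x, chart_dom x -> chart_cod (chart_map x);
  chart_inv_dom : forall a, chart_cod a -> chart_dom (chart_inv a);
  chart_mapK : forall x, chart_dom x -> chart_inv (chart_map x) = x;
  chart_invK : forall a, chart_cod a -> chart_map (chart_inv a) = a;
  chart_map_continuous : forall x, chart_dom x -> {for x, continuous chart_map};
  chart_inv_continuous : forall a, chart_cod a -> {for a, continuous chart_inv}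
}.

(* The smooth structure is the one generated by [atlas], which is not required
   to be maximal. *)
Record manifold (R : realType) (n : nat) := Manifold {
  manifold_space :> topologicalType;
  manifold_hausdorff : hausdorff_space manifold_space;
  manifold_second_countable : @second_countable manifold_space;
  atlas : set (chart R n manifold_space);
  chart_at : manifold_space -> chart R n manifold_space;
  chart_at_atlas : forall x, atlas (chart_at x);
  mem_chart_at : forall x, chart_dom (chart_at x) x;
  atlas_compatible : forall c d, atlas c -> atlas d ->
    smooth_on [set a | chart_cod c a /\ chart_dom d (chart_inv c a)]
              (d \o chart_inv c)
}.

(* T_x M is identified with R^n through the chart [chart_at x]; this is only a
   choice of linear coordinates on T_x M, and the passage to any other chart is
   given by the differential of the transition map. *)
Definition tangent (R : realType) (n : nat) (M : manifold R n) (x : M)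
  : lmodType R := 'rV[R]_n.

(* The inverse of the chart of TM induced by [c]: the tangent vector at
   [chart_inv c a] whose coordinates in the chart [c] are [w]. *)
Definition tangent_of_coord (R : realType) (n : nat) (M : manifold R n)
    (c : chart R n M) (a w : 'rV[R]_n) : tangent (chart_inv c a) :=
  'd (chart_at (chart_inv c a) \o chart_inv c) a w.

Definition smooth_map (R : realType) (n : nat) (M : manifold R n)
    (f : M -> M) : Prop :=
  continuous f /\
  forall c d : chart R n M, atlas c -> atlas d ->
    smooth_on [set a | chart_cod c a /\ chart_dom d (f (chart_inv c a))]
              (d \o f \o chart_inv c).

Definition diffeomorphism (R : realType) (n : nat) (M : manifold R n)
    (f : M -> M) : Prop :=
  smooth_map f /\ exists g : M -> M, [/\ smooth_map g, cancel f g & cancel g f].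

Definition differential (R : realType) (n : nat) (M : manifold R n)
    (f : M -> M) (x : M) (v : tangent x) : tangent (f x) :=
  'd (chart_at (f x) \o f \o chart_inv (chart_at x)) (chart_at x x) v.

(* [F] read in the chart of TM induced by [c]. *)
Definition in_chart (R : realType) (n : nat) (M : manifold R n)
    (F : forall x : M, tangent x -> R) (c : chart R n M)
    (p : 'rV[R]_n * 'rV[R]_n) : R :=
  F (chart_inv c p.1) (tangent_of_coord c p.1 p.2).

Definition fundamental_tensor (R : realType) (n : nat) (M : manifold R n)
    (F : forall x : M, tangent x -> R) (x : M) (v u w : tangent x) : R :=
  2^-1 * derive1 (fun t : R =>
           derive1 (fun s : R => F x (v + t *: u + s *: w) ^+ 2) 0) 0.

Record finsler_metric (R : realType) (n : nat) (M : manifold R n)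
    (F : forall x : M, tangent x -> R) : Prop := FinslerMetric {
  finsler_ge0 : forall (x : M) (v : tangent x), 0 <= F x v;
  finsler_continuous : forall c : chart R n M, atlas c ->
    forall p, chart_cod c p.1 -> {for p, continuous (in_chart F c)};
  finsler_smooth : forall c : chart R n M, atlas c ->
    smooth_on [set p | chart_cod c p.1 /\ p.2 != 0] (in_chart F c);
  finsler_eq0 : forall (x : M) (v : tangent x), F x v = 0 <-> v = 0;
  finsler_homogeneous : forall (x : M) (v : tangent x) (l : R),
    0 < l -> F x (l *: v) = l * F x v;
  finsler_posdef : forall (x : M) (v : tangent x), v != 0 ->
    forall u : tangent x, u != 0 -> 0 < fundamental_tensor F v u u
}.

Definition reversible (R : realType) (n : nat) (M : manifold R n)
    (F : forall x : M, tangent x -> R) : Prop :=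
  forall (x : M) (v : tangent x), F x (- v) = F x v.

(* The isometry group, as a subset of the space of self-maps of [M] with the
   compact-open topology. *)
Definition Iso (R : realType) (n : nat) (M : manifold R n)
    (F : forall x : M, tangent x -> R) : set {compact-open, M -> M} :=
  [set f | diffeomorphism f /\
           forall (x : M) (v : tangent x), F (f x) (differential f v) = F x v].

Definition identity_component (R : realType) (n : nat) (M : manifold R n)
    (G : set {compact-open, M -> M}) : set {compact-open, M -> M} :=
  connected_component G (@idfun M : {compact-open, M -> M}).

(* Main.v *)
From HB Require Import structures.
Require Import Defs.
From mathcomp Require Import all_boot all_order all_algebra.
From mathcomp Require Import all_classical all_reals all_analysis.
From mathcomp Require Import ring lra.

Set Implicit Arguments.
Unset Strict Implicit.
Unset Printing Implicit Defensive.

Import Order.TTheory GRing.Theory Num.Theory.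
Import numFieldNormedType.Exports.

Local Open Scope classical_set_scope.
Local Open Scope ring_scope.

(* Positivity of the fundamental tensor splits along a direction u: subtracting
   a multiple of v from u, one may assume dF_v(u) = 0, and then g_v(u,u) is F(v)
   times the second derivative of F. Hence that second derivative is
   nonnegative and vanishes only along v, which makes F + F(-.) strongly convex;
   for the other metric the fundamental tensors simply add up.

   An isometry f of both symmetrizations preserves the unordered pair
   {F(v), F(-v)}. Where F(-v) < F(v), we show that the sign chosen by f at v is
   locally constant in f for the compact-open topology; connectedness then
   forces the sign of the identity. Since C^0-closeness does not control
   differentials, the argument is a lower semicontinuity property: a supporting
   linear form of F at df(v), read in charts, increases along f o gamma, hence
   also along g o gamma for every g uniformly close to f, where gamma is a short
   curve in the direction v; so F(dg(gamma')) exceeds the midpoint k of F(v) and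
   F(-v) somewhere on gamma. As F(dg(gamma')) never takes the value k, it
   exceeds k at v itself. *)

(** * Calculus of C^k maps *)

Section Ck.
Context {R : realType}.

(** The first-order expansion of [f] at [x] is also one of [g], with the same linear part;
    [diff_unique] then identifies ['d g x]. *)
Lemma near_eq_differentiable (V W : normedModType R) (f g : V -> W) (x : V) :
  {near x, f =1 g} -> differentiable f x -> differentiable g x.
Proof.
move=> fg df.
have dg : continuous ('d f x) /\ g \o shift x = cst (g x) + 'd f x +o_ 0 id.
  split; first exact: (diff_continuous df).
  have /diff_locally/eqaddoP fo := df.
  apply/eqaddoP => _/posnumP[e].
  have foe := fo e%:num [gt0 of e%:num].
  have fgx : \forall h \near 0, f (h + x) = g (h + x).
    by rewrite (near_shift x) sub0r; apply: filterS fg => z /=; rewrite subrK.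
  apply: filterS2 fgx foe => h fgh.
  by rewrite !fctE /= fgh (nbhs_singleton fg).
by apply/diff_locallyP; rewrite (diff_unique dg.1 dg.2).
Qed.

Lemma near_eq_diff (V W : normedModType R) (f g : V -> W) (x v : V) :
  {near x, f =1 g} -> differentiable f x -> 'd f x v = 'd g x v.
Proof.
move=> fg df; rewrite -!deriveE//; first exact: near_eq_derive.
exact: near_eq_differentiable df.
Qed.

Lemma open_near_eq (V W : normedModType R) (A : set V) (f g : V -> W) (x : V) :
  open A -> A x -> {in A, f =1 g} -> {near x, f =1 g}.
Proof.
move=> oA Ax fg; have xA : nbhs x A by exact: open_nbhs_nbhs.
by apply: filterS xA => y Ay; apply: fg; rewrite inE.
Qed.

(** Directional derivatives are local, hence the openness of [A]. The inductions below use this to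
    replace the derivative of a compound function by its explicit formula. *)
Lemma C_k_ext (V W : normedModType R) k (A : set V) (f g : V -> W) :
  open A -> {in A, f =1 g} -> C_k k A f -> C_k k A g.
Proof.
move=> oA; elim: k f g => [|k IH] f g fg /=.
  move=> cf x Ax; have := cf x Ax.
  rewrite /prop_for /continuous_at (fg x) ?inE//; apply: cvg_trans.
  by apply: near_eq_cvg; exact: open_near_eq fg.
move=> [df cdf]; split.
  move=> x Ax; apply: near_eq_differentiable (df x Ax).
  exact: open_near_eq fg.
move=> v; apply: IH (cdf v) => x /[!inE] Ax.
by apply: near_eq_derive; exact: open_near_eq fg.
Qed.

Lemma C_kW (V W : normedModType R) k (A : set V) (f : V -> W) :
  C_k k.+1 A f -> C_k k A f.
Proof.
elim: k f => [|k IH] f [df cdf].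
  by move=> x Ax; exact/differentiable_continuous/df.
by split=> // v; exact: IH (cdf v).
Qed.

Lemma C_kD (V W : normedModType R) k (A : set V) (f g : V -> W) :
  open A -> C_k k A f -> C_k k A g -> C_k k A (fun x => f x + g x).
Proof.
move=> oA; elim: k f g => [|k IH] f g /=.
  by move=> cf cg x Ax; apply: continuousD; [exact: cf|exact: cg].
move=> [df cdf] [dg cdg]; split=> [x Ax|v].
  by apply: differentiableD; [exact: df|exact: dg].
apply: C_k_ext (IH _ _ (cdf v) (cdg v)) => // x /[!inE] Ax.
by rewrite -deriveD//; apply: diff_derivable; [exact: df|exact: dg].
Qed.

Lemma C_k_cst (V W : normedModType R) k (A : set V) (a : W) :
  C_k k A (fun=> a).
Proof.
elim: k a => [|k IH] a /=; first by move=> x _; exact: cvg_cst.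
split=> [x _|v]; first exact: differentiable_cst.
suff -> : 'D_v (fun=> a) = (fun=> 0) :> (V -> W) by exact: IH.
by apply/funext => x; rewrite derive_cst.
Qed.

Lemma C_kM (V : normedModType R) k (A : set V) (f g : V -> R) :
  open A -> C_k k A f -> C_k k A g -> C_k k A (fun x => f x * g x).
Proof.
move=> oA; elim: k f g => [|k IH] f g /=.
  by move=> cf cg x Ax; apply: continuousM; [exact: cf|exact: cg].
move=> Cf Cg; have [df cdf] := Cf; have [dg cdg] := Cg; split=> [x Ax|v].
  by apply: differentiableM; [exact: df|exact: dg].
have Cv := C_kD oA (IH _ _ (C_kW Cf) (cdg v)) (IH _ _ (C_kW Cg) (cdf v)).
apply: C_k_ext Cv => // x /[!inE] Ax.
by rewrite -deriveM//; apply: diff_derivable; [exact: df|exact: dg].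
Qed.

(** By the chain rule, the derivative along [v] is ['D_(L v) f] composed with the same affine map,
    so the induction closes. It serves for the inclusion of a fibre and for reversal. *)
Lemma C_k_comp_affine (U V W : normedModType R) k (A : set V) (B : set U)
    (L : {linear U -> V}) (b : V) (f : V -> W) :
  open B -> continuous L -> (forall x, B x -> A (b + L x)) -> C_k k A f ->
  C_k k B (fun x => f (b + L x)).
Proof.
move=> oB cL BA; elim: k f => [|k IH] f /=.
  move=> cf x Bx; apply: (@continuous_comp _ _ _ (fun x => b + L x)).
    by apply: continuousD; [exact: cvg_cst|exact: cL].
  exact/cf/BA.
have dL x : is_diff x (fun x => b + L x) L.
  have dLx : is_diff x L L.
    by apply: DiffDef; [exact: linear_differentiable|rewrite diff_lin].
  by apply: is_diff_eq; rewrite add0r.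
move=> [df cdf]; have dfL x : B x -> differentiable (fun x => f (b + L x)) x.
  by move=> Bx; apply: (@differentiable_comp _ _ _ _ (fun x => b + L x)) => //;
    exact/df/BA.
split=> // v; apply: C_k_ext (IH _ (cdf (L v))) => // x /[!inE] Bx /=.
rewrite !deriveE//; [|exact/dfL|exact/df/BA].
rewrite (@diff_comp _ _ _ _ (fun x => b + L x))//=; last exact/df/BA.
by rewrite diff_val.
Qed.

(** The inverse root comes before the root because [h' = - h ^ 3 / 2] is polynomial in [h], which
    makes the induction on [k] close; the root is then [q] times its inverse root. *)
Lemma C_k_rsqrt (V : normedModType R) k (A : set V) (q : V -> R) :
  open A -> (forall x, A x -> 0 < q x) -> C_k k A q ->
  C_k k A (fun x => (Num.sqrt (q x))^-1).
Proof.
move=> oA q0; pose h (s : R) : R := (Num.sqrt s)^-1.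
have dh (s : R) : 0 < s -> is_derive s 1 h (- 2^-1 * h s ^+ 3).
  move=> s0; have sn0 : Num.sqrt s != 0 by rewrite gt_eqF// sqrtr_gt0.
  have [ds _] := is_derive1_sqrt s0.
  split; first exact: derivableV.
  rewrite deriveV// derive_sqrt// /h /GRing.scale/=.
  by field.
have hd (s : R) : 0 < s -> differentiable h s.
  by move=> /dh [/derivable1_diffP].
elim: k q q0 => [|k IH] q q0 /=.
  move=> cq x Ax; apply: (@continuous_comp _ _ _ q h); first exact: cq.
  by apply: differentiable_continuous; apply/hd/q0.
move=> Cq; have [dq cdq] := Cq; split=> [x Ax|v].
  by apply: (@differentiable_comp _ _ _ _ q h); [exact: dq|exact/hd/q0].
have Cu := IH _ q0 (C_kW Cq).
have Cp := C_kM oA (C_kM oA (C_k_cst k A (- 2^-1 : R)) (C_kM oA Cu (C_kM oA Cu Cu)))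
             (cdq v).
apply: C_k_ext Cp => // x /[!inE] Ax.
rewrite (deriveE (f := h \o q)); last first.
  by apply: differentiable_comp; [exact: dq|exact/hd/q0].
rewrite diff_comp /=; [|exact: dq|exact/hd/q0].
rewrite diff1E; last exact/hd/q0.
rewrite derive1E (@derive_val _ _ _ _ _ _ _ (dh _ (q0 _ Ax))) -deriveE; last exact: dq.
by rewrite /GRing.scale/= /h; ring.
Qed.

Lemma C_k_sqrt (V : normedModType R) k (A : set V) (q : V -> R) :
  open A -> (forall x, A x -> 0 < q x) -> C_k k A q ->
  C_k k A (fun x => Num.sqrt (q x)).
Proof.
move=> oA q0 Cq; apply: C_k_ext (C_kM oA Cq (C_k_rsqrt oA q0 Cq)) => // x.
rewrite inE => Ax /=; rewrite -{1}[q x]sqr_sqrtr ?ltW ?q0// expr2 mulfK//.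
by rewrite gt_eqF// sqrtr_gt0 q0.
Qed.

Lemma is_derive_line (V W : normedModType R) (f : V -> W) (a u : V) (t : R) :
  differentiable f (a + t *: u) ->
  is_derive t 1 (fun s : R => f (a + s *: u)) ('D_u f (a + t *: u)).
Proof.
move=> df; have dl : is_diff t (fun s : R => a + s *: u) ( *:%R^~ u).
  by apply: is_diff_eq; rewrite add0r.
have dfl : differentiable (fun s : R => f (a + s *: u)) t.
  by apply: (@differentiable_comp _ _ _ _ (fun s : R => a + s *: u)).
split; first exact: diff_derivable.
rewrite !deriveE// (@diff_comp _ _ _ _ (fun s : R => a + s *: u))//=.
by rewrite diff_val scale1r.
Qed.

Lemma is_derive_linear_line (V W : normedModType R) (l : {linear W -> R})
    (f : V -> W) (a u : V) (t : R) :
  continuous l -> differentiable f (a + t *: u) ->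
  is_derive t 1 (fun s : R => l (f (a + s *: u))) (l ('d f (a + t *: u) u)).
Proof.
move=> cl df.
have dl : differentiable l (f (a + t *: u)) by exact: linear_differentiable.
have dlf := differentiable_comp df dl.
apply: (is_derive_eq (is_derive_line dlf)).
by rewrite (deriveE _ dlf) (diff_comp df dl) /= diff_lin.
Qed.

End Ck.

(** * Minkowski norms *)

Section Minkowski.
Context {R : realType} {V : normedModType R}.
Implicit Types (N : V -> R) (u v w : V).

Lemma line_continuous v u : continuous (fun s : R => v + s *: u).
Proof.
move=> t; suff : {for t, continuous (fun s : R => v + s *: u)} by [].
by apply: continuousD; [exact: cvg_cst|exact: scalel_continuous].
Qed.

Lemma line_near (A : set V) v u (t : R) :
  open A -> A (v + t *: u) -> \forall s \near t, A (v + s *: u).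
Proof.
by move=> oA Av; apply: (@line_continuous v u t); exact: open_nbhs_nbhs.
Qed.

(** Turns the nested one-variable derivatives of [fundamental_tensor], on the diagonal, into
    iterated directional derivatives. As [A] is open, the inner derivative is known for all [t] near
    0. *)
Lemma derive1_derive1_line (A : set V) (G : V -> R) u v :
  open A -> C_k 2 A G -> A v ->
  derive1 (fun t : R => derive1 (fun s : R => G (v + t *: u + s *: u)) 0) 0 =
  'D_u ('D_u G) v.
Proof.
move=> oA [dG CdG] Av; have [dG1 _] := CdG u.
have A0 : A (v + 0 *: u) by rewrite scale0r addr0.
rewrite derive1E (@near_eq_derive _ _ _ _ (fun t : R => 'D_u G (v + t *: u))).
  have := is_derive_line (dG1 _ A0).
  by move=> /@derive_val ->; rewrite scale0r addr0.
apply: filterS (line_near oA A0) => t At.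
have At0 : A (v + t *: u + 0 *: u) by rewrite scale0r addr0.
rewrite derive1E; have := is_derive_line (dG _ At0).
by move=> /@derive_val ->; rewrite scale0r addr0.
Qed.

Lemma derive2D (A : set V) (G H : V -> R) u v :
  open A -> C_k 2 A G -> C_k 2 A H -> A v ->
  'D_u ('D_u (fun w => G w + H w)) v = 'D_u ('D_u G) v + 'D_u ('D_u H) v.
Proof.
move=> oA [dG CdG] [dH CdH] Av; have [dG1 _] := CdG u; have [dH1 _] := CdH u.
rewrite -deriveD; [|exact/diff_derivable/dG1|exact/diff_derivable/dH1].
apply: near_eq_derive; apply: (@open_near_eq _ _ _ A) => // w /[!inE] Aw.
by rewrite deriveD//; apply: diff_derivable; [exact: dG|exact: dH].
Qed.

Lemma derive2_sqr (A : set V) (G : V -> R) u v :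
  open A -> C_k 2 A G -> A v ->
  'D_u ('D_u (fun w => G w ^+ 2)) v =
  2 * (G v * 'D_u ('D_u G) v + 'D_u G v ^+ 2).
Proof.
move=> oA [dG CdG] Av; have [dG1 _] := CdG u.
have d w : A w -> derivable G w u by move=> Aw; exact/diff_derivable/dG.
have d1 : derivable ('D_u G) v u by exact/diff_derivable/dG1.
have E w : A w -> 'D_u (fun w => G w ^+ 2) w = (fun w => G w * 'D_u G w + G w * 'D_u G w) w.
  move=> Aw; have /= := deriveM (d _ Aw) (d _ Aw).
  by under eq_fun do rewrite expr2.
rewrite (@near_eq_derive _ _ _ _ ((G * 'D_u G) + (G * 'D_u G))).
  have dGG1 := derivableM (d _ Av) d1.
  rewrite (deriveD dGG1 dGG1) (deriveM (d _ Av) d1) /GRing.scale/=.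
  by rewrite expr2 mulr_natl mulr2n.
by apply: (@open_near_eq _ _ _ A) => // w /[!inE] Aw; rewrite E.
Qed.

(** The conditions that a Finsler metric satisfies on a single tangent space. *)
Record minkowski_norm N : Prop := MinkowskiNorm {
  minkowski_smooth : smooth_on [set w | w != 0] N;
  minkowski_ge0 : forall w, 0 <= N w;
  minkowski_eq0 : forall w, N w = 0 <-> w = 0;
  minkowski_homogeneous : forall w (l : R), 0 < l -> N (l *: w) = l * N w;
  minkowski_posdef : forall v u, v != 0 -> u != 0 ->
    0 < 2^-1 * derive1 (fun t : R =>
          derive1 (fun s : R => N (v + t *: u + s *: u) ^+ 2) 0) 0
}.

Lemma open_neq0 : open [set w : V | w != 0].
Proof.
have -> : [set w : V | w != 0] = ~` [set 0].
  by apply/seteqP; split => w /= /eqP.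
exact/closed_openC/accessible_closed_set1/hausdorff_accessible/norm_hausdorff.
Qed.

Lemma fundamental_tensorE N u v : smooth_on [set w | w != 0] N -> v != 0 ->
  2^-1 * derive1 (fun t : R =>
          derive1 (fun s : R => N (v + t *: u + s *: u) ^+ 2) 0) 0 =
  N v * 'D_u ('D_u N) v + 'D_u N v ^+ 2.
Proof.
move=> sN v0; have sN2 : C_k 2 [set w | w != 0] (fun w => N w ^+ 2).
  exact: C_kM open_neq0 (sN 2%N) (sN 2%N).
rewrite (derive1_derive1_line u open_neq0 sN2)//.
by rewrite (derive2_sqr u open_neq0 (sN 2%N))// mulKf.
Qed.

Section Theory.
Variables (N : V -> R) (mN : minkowski_norm N).

Let sN := minkowski_smooth mN.
Let dN w : w != 0 -> differentiable N w.
Proof. by have [dN _] := sN 1; exact: dN. Qed.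
Let dN1 u w : w != 0 -> differentiable ('D_u N) w.
Proof. by have [_ /(_ u)[dN1 _]] := sN 2; exact: dN1. Qed.

Lemma minkowski_gt0 v : v != 0 -> 0 < N v.
Proof.
move=> v0; rewrite lt_def minkowski_ge0// andbT.
by apply: contra v0 => /eqP/(minkowski_eq0 mN)/eqP.
Qed.

(** Differentiate [N ((1 + t) *: v) = (1 + t) * N v] at [t = 0]. *)
Lemma minkowski_euler v : v != 0 -> 'D_v N v = N v.
Proof.
move=> v0; have d : differentiable N (v + 0 *: v) by rewrite scale0r addr0; exact: dN.
have := is_derive_line d => /@derive_val; rewrite scale0r addr0 => <-.
rewrite (@near_eq_derive _ _ _ _ (fun t : R => t * N v + N v)).
  have did : derivable (@id R) 0 1 by exact: derivable_id.
  have dl : derivable (fun t : R => t * N v) 0 1.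
    by apply: (@derivableM _ _ id (cst (N v))); [|exact: derivable_cst].
  have dc : derivable (fun _ : R => N v) 0 1 by exact: derivable_cst.
  rewrite (deriveD dl dc) derive_cst addr0.
  by rewrite (deriveMr (N v) did) derive_id mulr1.
have t1 : \forall t \near (0 : R), -1 < t by apply: lt_nbhsr; rewrite ltrN10.
apply: filterS t1 => t t1.
rewrite -{1}[v]scale1r -scalerDl minkowski_homogeneous//; last lra.
by rewrite mulrDl mul1r addrC.
Qed.

(** Differentiating [N (l *: w) = l * N w] in [w] along [u] gives the identity multiplied by [l] on
    both sides. *)
Lemma derive_homogeneous v u (l : R) : v != 0 -> 0 < l ->
  'D_u N (l *: v) = 'D_u N v.
Proof.
move=> v0 l0; have lv0 : l *: v != 0 by rewrite scaler_eq0 negb_or gt_eqF.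
have dNl : differentiable (N \o *:%R l) v by exact: differentiable_comp (dN lv0).
have E : N \o *:%R l = l \*o N.
  by apply/funext => w /=; rewrite minkowski_homogeneous.
have dNu : derivable N v u by exact/diff_derivable/dN.
have := deriveMl l dNu.
rewrite -E (deriveE _ dNl) diff_comp//=; last exact: dN.
rewrite diff_val linearZ /= -deriveE; last exact: dN.
by apply: mulfI; rewrite gt_eqF.
Qed.

Lemma derive2_radial v u : v != 0 -> 'D_v ('D_u N) v = 0.
Proof.
move=> v0; have d : differentiable ('D_u N) (v + 0 *: v).
  by rewrite scale0r addr0; exact: dN1.
have := is_derive_line d => /@derive_val; rewrite scale0r addr0 => <-.
rewrite (@near_eq_derive _ _ _ _ (fun=> 'D_u N v)) ?derive_cst//.
have t1 : \forall t \near (0 : R), -1 < t by apply: lt_nbhsr; rewrite ltrN10.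
apply: filterS t1 => t t1.
have -> : v + t *: v = (1 + t) *: v by rewrite scalerDl scale1r.
by rewrite derive_homogeneous//; lra.
Qed.

Section Hessian.
Variables (v u : V).
Hypothesis v0 : v != 0.
(** Euler's identity ['D_v N v = N v] makes this the coefficient for which ['D_u' N v = 0]. *)
Let a := 'D_u N v / N v.
Let u' := u - a *: v.

Let Nv0 : N v != 0.
Proof. by rewrite gt_eqF// minkowski_gt0. Qed.

Let derive_u w : w != 0 -> 'D_u N w = 'D_u' N w + a * 'D_v N w.
Proof.
move=> w0; rewrite !deriveE; try exact: dN.
by rewrite -[a * _]linearZ -linearD /u' subrK.
Qed.

Let derive_u' : 'D_u' N v = 0.
Proof.
apply/eqP; rewrite -(inj_eq (addIr (a * 'D_v N v))) -derive_u// add0r.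
by rewrite minkowski_euler// /a divfK.
Qed.

(* ['D_u N] is homogeneous of degree 0, so its radial derivative vanishes; this
   and Euler's identity along [v + s *: u'] replace the symmetry of second
   derivatives. *)
Let derive2_u' : 'D_u ('D_u N) v = 'D_u' ('D_u' N) v.
Proof.
have dv : differentiable ('D_u N) v by exact: dN1.
have -> : 'D_u ('D_u N) v = 'D_u' ('D_u N) v + a * 'D_v ('D_u N) v.
  by rewrite !deriveE// -[a * _]linearZ -linearD /u' subrK.
rewrite derive2_radial// mulr0 addr0.
have A0 : v + 0 *: u' != 0 by rewrite scale0r addr0.
pose h s := N (v + s *: u'); pose h1 s := 'D_u' N (v + s *: u').
have dh : is_derive (0 : R) 1 h 0.
  have := is_derive_line (dN A0); rewrite scale0r addr0 derive_u'; exact.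
have dh1 : is_derive (0 : R) 1 h1 ('D_u' ('D_u' N) v).
  by have := is_derive_line (dN1 u' A0); rewrite scale0r addr0; exact.
have dI : is_derive (0 : R) 1 (@id R) 1 by exact: is_derive_id.
have dc : is_derive (0 : R) 1 (fun _ : R => a) 0 by exact: is_derive_cst.
have h10 : h1 0 = 0 by rewrite /h1 scale0r addr0.
have /@derive_val := is_derive_line (dN1 u A0); rewrite scale0r addr0 => <-.
have dE : is_derive (0 : R) 1 (h1 + cst a * (h - id * h1)) ('D_u' ('D_u' N) v).
  apply: (is_derive_eq (is_deriveD dh1 (is_deriveM dc (is_deriveB dh (is_deriveM dI dh1))))).
  rewrite h10 /GRing.scale/=.
  by rewrite !mul0r addr0 subrr !mulr0 !addr0.
rewrite -(@derive_val _ _ _ _ _ _ _ dE); apply: near_eq_derive.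
apply: filterS (line_near open_neq0 A0) => s /= vs0.
rewrite derive_u// !fctE/= /h1 /h; congr (_ + a * _).
(* Euler: ['D_v N = N - s 'D_u' N] at [v + s *: u'] *)
rewrite -minkowski_euler// -{2}[v](addrK (s *: u')) !deriveE; try exact: dN.
by rewrite linearB linearZ.
Qed.

Lemma minkowski_hessian_ge0 : 0 <= 'D_u ('D_u N) v.
Proof.
rewrite derive2_u'; have [->|u'0] := eqVneq u' 0; first by rewrite derive0.
have := minkowski_posdef mN v0 u'0; rewrite (fundamental_tensorE _ sN v0).
rewrite derive_u' expr2 mul0r addr0 (pmulr_rgt0 _ (minkowski_gt0 v0)).
exact: ltW.
Qed.

Lemma minkowski_hessian_eq0 : 'D_u ('D_u N) v = 0 -> u = a *: v.
Proof.
rewrite derive2_u' => h0; apply/eqP; rewrite -subr_eq0; apply/negPn/negP => u'0.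
have := minkowski_posdef mN v0 u'0; rewrite (fundamental_tensorE _ sN v0).
by rewrite derive_u' h0 expr2 mul0r mulr0 addr0 ltxx.
Qed.

End Hessian.

(** [N] lies above its tangent hyperplane at [v]. If the segment from [v] to [w] avoids 0, [N] is
    convex along it and two applications of the mean value theorem suffice; otherwise [w] is a
    nonpositive multiple of [v] and the left-hand side is nonpositive. *)
Lemma minkowski_fundamental v w : v != 0 -> 'D_w N v <= N w.
Proof.
move=> v0; set u := w - v.
have [vt|] := pselect (forall t : R, 0 <= t -> t <= 1 -> v + t *: u != 0).
  pose f (t : R) := N (v + t *: u); pose f1 (t : R) := 'D_u N (v + t *: u).
  have df (t : R) : 0 <= t -> t <= 1 -> is_derive t 1 f (f1 t).
    by move=> t0 t1; apply: is_derive_line; exact/dN/vt.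
  have df1 (t : R) : 0 <= t -> t <= 1 ->
      is_derive t 1 f1 ('D_u ('D_u N) (v + t *: u)).
    by move=> t0 t1; apply: is_derive_line; exact/dN1/vt.
  have [||c] := @MVT R f f1 0 1 ltr01.
  - by move=> t; rewrite in_itv/= => /andP[/ltW ? /ltW ?]; exact: df.
  - apply: derivable_within_continuous => t; rewrite in_itv/= => /andP[? ?].
    by have [] := df t.
  rewrite in_itv/= subr0 mulr1 => /andP[c0 c1] fc.
  (* The slope at [c] is at least the slope at 0, because the Hessian is nonnegative in between. *)
  have [||e] := @MVT R f1 (fun t => 'D_u ('D_u N) (v + t *: u)) 0 c c0.
  - move=> t; rewrite in_itv/= => /andP[/ltW ? /ltW ?]; apply: df1 => //; lra.
  - apply: derivable_within_continuous => t; rewrite in_itv/= => /andP[? ?].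
    by have [||] := df1 t => //; lra.
  rewrite in_itv/= subr0 => /andP[e0 ec] f1c.
  have : 0 <= 'D_u ('D_u N) (v + e *: u) * c.
    by apply: mulr_ge0 (ltW c0); apply/minkowski_hessian_ge0/vt; lra.
  rewrite -f1c subr_ge0 /f1 scale0r addr0 => {}f1c.
  have vu : v + u = w by rewrite addrC subrK.
  move: fc; rewrite /f scale1r scale0r addr0 vu => fc.
  have Dw : 'D_w N v = 'D_u N v + N v.
    rewrite -[X in _ + X]minkowski_euler// !deriveE; try exact: dN.
    by rewrite -linearD subrK.
  by rewrite Dw -lerBrDr fc.
(* The segment meets the origin at parameter [t], and solving for [w] gives the multiple of [v]. *)
move=> /existsNP[t /not_implyP[t0 /not_implyP[t1 /negP/negPn/eqP vt]]].
have tn0 : t != 0 by apply: contra_neq v0 => tE; rewrite -vt tE scale0r addr0.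
have {}vt : w = - ((1 - t) / t) *: v.
  apply: (scalerI tn0); rewrite scalerA mulrN mulrCA divff// mulr1.
  apply/eqP; rewrite -subr_eq0 -scaleNr opprK; apply/eqP.
  by rewrite -vt /u scalerBr scalerBl scale1r addrCA addrC.
apply: le_trans (minkowski_ge0 mN w).
rewrite {1}vt deriveE; last exact: dN.
rewrite linearZ /= -deriveE ?minkowski_euler//; last exact: dN.
rewrite /GRing.scale/= mulNr oppr_le0 mulr_ge0 ?minkowski_ge0// divr_ge0//.
by rewrite subr_ge0.
Qed.

End Theory.
End Minkowski.

(** * Sums, Euclidean combinations and reversals of Minkowski norms *)

Section MinkowskiOperations.
Context {R : realType} {V : normedModType R}.
Implicit Types (N P : V -> R) (u v w : V).

Lemma minkowski_normD N P : minkowski_norm N -> minkowski_norm P ->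
  minkowski_norm (fun w => N w + P w).
Proof.
move=> mN mP; have sNP : smooth_on [set w | w != 0] (fun w => N w + P w).
  by move=> k; exact: C_kD open_neq0 (minkowski_smooth mN k) (minkowski_smooth mP k).
split=> //.
- by move=> w; exact: addr_ge0 (minkowski_ge0 mN w) (minkowski_ge0 mP w).
- move=> w; split.
    move=> /eqP; rewrite paddr_eq0 ?minkowski_ge0// => /andP[/eqP + _].
    by move/(minkowski_eq0 mN).
  by move=> w0; rewrite (minkowski_eq0 mN w).2// (minkowski_eq0 mP w).2// addr0.
- by move=> w l l0; rewrite (minkowski_homogeneous mN _ l0) (minkowski_homogeneous mP _ l0) mulrDr.
move=> v u v0 u0; rewrite (fundamental_tensorE _ sNP v0).
rewrite (derive2D u open_neq0 (minkowski_smooth mN 2%N) (minkowski_smooth mP 2%N) v0).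
have dN : derivable N v u.
  by apply: diff_derivable; have [dN _] := minkowski_smooth mN 1; exact: dN.
have dP : derivable P v u.
  by apply: diff_derivable; have [dP _] := minkowski_smooth mP 1; exact: dP.
have -> : 'D_u (fun w => N w + P w) v = 'D_u N v + 'D_u P v by exact: deriveD.
have Nv := minkowski_gt0 mN v0; have Pv := minkowski_gt0 mP v0.
have hN := minkowski_hessian_ge0 mN u v0; have hP := minkowski_hessian_ge0 mP u v0.
have [h0|h0] := ltP 0 ('D_u ('D_u N) v + 'D_u ('D_u P) v).
  by apply: ltr_pwDl; [apply: mulr_gt0 => //; exact: addr_gt0|exact: sqr_ge0].
(* In the degenerate case both Hessians vanish, so [u] is a multiple of [v] in two ways. The
   coefficients agree, and the derivative of the sum is this nonzero coefficient times
   [N v + P v]. *)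
have /andP[/eqP hN0 /eqP hP0] :
    ('D_u ('D_u N) v == 0) && ('D_u ('D_u P) v == 0).
  by rewrite -(paddr_eq0 hN hP) eq_le h0 (addr_ge0 hN hP).
have uN := minkowski_hessian_eq0 mN v0 hN0.
have uP := minkowski_hessian_eq0 mP v0 hP0.
rewrite hN0 hP0 addr0 mulr0 add0r.
set a := 'D_u N v in uN *; set b := 'D_u P v in uP *.
have ab : a / N v = b / P v.
  have : (a / N v - b / P v) *: v = 0 by rewrite scalerBl -uN -uP subrr.
  by move=> /eqP; rewrite scaler_eq0 (negbTE v0) orbF subr_eq0 => /eqP.
have a0 : a != 0 by apply: contra_neq u0 => a0; rewrite uN a0 mul0r scale0r.
have -> : a + b = a / N v * (N v + P v).
  by rewrite mulrDr divfK ?gt_eqF// ab divfK// gt_eqF.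
rewrite exprn_even_gt0//=; apply: mulf_neq0; last by rewrite gt_eqF// addr_gt0.
by apply: mulf_neq0 => //; rewrite invr_eq0 gt_eqF.
Qed.

Lemma minkowski_norm_hypot N P : minkowski_norm N -> minkowski_norm P ->
  minkowski_norm (fun w => Num.sqrt (N w ^+ 2 + P w ^+ 2)).
Proof.
move=> mN mP; pose Q w := N w ^+ 2 + P w ^+ 2.
have sN2 k : C_k k [set w | w != 0] (fun w => N w ^+ 2).
  exact: C_kM open_neq0 (minkowski_smooth mN k) (minkowski_smooth mN k).
have sP2 k : C_k k [set w | w != 0] (fun w => P w ^+ 2).
  exact: C_kM open_neq0 (minkowski_smooth mP k) (minkowski_smooth mP k).
have sQ k : C_k k [set w | w != 0] Q by exact: C_kD open_neq0 (sN2 k) (sP2 k).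
have Q0 w : 0 <= Q w by apply: addr_ge0; exact: sqr_ge0.
split.
- move=> k; apply: C_k_sqrt open_neq0 _ (sQ k) => w /= w0.
  by apply: ltr_pwDl (sqr_ge0 _); rewrite exprn_gt0// minkowski_gt0.
- by move=> w; exact: sqrtr_ge0.
- move=> w; split.
    move=> /eqP; rewrite sqrtr_eq0 => Qw.
    have /eqP : Q w = 0 by apply/eqP; rewrite eq_le Qw Q0.
    rewrite paddr_eq0 ?sqr_ge0// sqrf_eq0 => /andP[/eqP + _].
    by move/(minkowski_eq0 mN).
  move=> w0; rewrite (minkowski_eq0 mN w).2// (minkowski_eq0 mP w).2//.
  by rewrite expr2 mul0r addr0 sqrtr0.
- move=> w l l0; rewrite (minkowski_homogeneous mN _ l0) (minkowski_homogeneous mP _ l0).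
  rewrite !exprMn -mulrDr.
  by rewrite sqrtrM ?sqr_ge0// sqrtr_sqr gtr0_norm.
move=> v u v0 u0.
have -> : (fun t : R => derive1 (fun s : R =>
    Num.sqrt (N (v + t *: u + s *: u) ^+ 2 + P (v + t *: u + s *: u) ^+ 2) ^+ 2) 0)
  = (fun t : R => derive1 (fun s : R => Q (v + t *: u + s *: u)) 0).
  apply/funext => t; congr (derive1 _ 0); apply/funext => s.
  exact: (sqr_sqrtr (Q0 (v + t *: u + s *: u))).
rewrite (derive1_derive1_line u open_neq0 (sQ 2%N) v0).
rewrite (derive2D u open_neq0 (sN2 2%N) (sP2 2%N) v0).
rewrite -(derive1_derive1_line u open_neq0 (sN2 2%N) v0).
rewrite -(derive1_derive1_line u open_neq0 (sP2 2%N) v0) mulrDr.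
by apply: addr_gt0; apply: minkowski_posdef.
Qed.

(** The tensor of the reversed norm at [v] in direction [u] is that of [N] at [- v] in direction
    [- u]. *)
Lemma minkowski_norm_opp N : minkowski_norm N ->
  minkowski_norm (fun w => N (- w)).
Proof.
move=> mN; split.
- move=> k; have cN : continuous (-%R : V -> V) by exact: opp_continuous.
  apply: C_k_ext open_neq0 _ (C_k_comp_affine (b := 0) open_neq0 cN _ (minkowski_smooth mN k)).
    by move=> w _; rewrite add0r.
  by move=> w /=; rewrite add0r oppr_eq0.
- by move=> w; exact: minkowski_ge0.
- move=> w; rewrite (minkowski_eq0 mN); split => [/eqP|->]; last exact: oppr0.
  by rewrite oppr_eq0 => /eqP.
- by move=> w l l0; rewrite -scalerN (minkowski_homogeneous mN _ l0).
move=> v u v0 u0.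
have -> : (fun t : R => derive1 (fun s : R => N (- (v + t *: u + s *: u)) ^+ 2) 0)
  = (fun t : R => derive1 (fun s : R => N (- v + t *: - u + s *: - u) ^+ 2) 0).
  apply/funext => t; congr (derive1 _ 0); apply/funext => s.
  by rewrite !opprD !scalerN.
by apply: minkowski_posdef => //; rewrite oppr_eq0.
Qed.

End MinkowskiOperations.

(** * Finsler metrics in charts *)

Section Charts.
Context {R : realType} {n : nat} {M : manifold R n}.
Implicit Types (c d e : chart R n M) (x : M) (w : 'rV[R]_n).

Lemma chart_preimage_open c (B : set 'rV[R]_n) : open B ->
  open [set x | chart_dom c x /\ B (c x)].
Proof.
move=> oB; rewrite openE => x [cx Bx].
have Bc : nbhs x (c @^-1` B).
  by apply: (chart_map_continuous cx); exact: open_nbhs_nbhs.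
have cc : nbhs x (chart_dom c).
  by apply: open_nbhs_nbhs; split => //; exact: chart_dom_open.
exact: filterI cc Bc.
Qed.

Lemma chart_inv_preimage_open c (f : M -> M) (U : set M) : continuous f ->
  open U -> open [set a | chart_cod c a /\ U (f (chart_inv c a))].
Proof.
move=> cf oU; rewrite openE => a [ca Ua].
have Uc : nbhs a (chart_inv c @^-1` (f @^-1` U)).
  apply: (chart_inv_continuous ca); apply: cf; exact: open_nbhs_nbhs.
have cc : nbhs a (chart_cod c).
  by apply: open_nbhs_nbhs; split => //; exact: chart_cod_open.
exact: filterI cc Uc.
Qed.

(** Transition maps are coordinate expressions of the identity, so statements about
    [d \o g \o chart_inv c] also cover changes of chart. *)
Lemma smooth_map_id : smooth_map (@idfun M).
Proof. by split=> [x|c d ac ad]; [exact: cvg_id|exact: atlas_compatible]. Qed.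

Lemma smooth_map_differentiable (g : M -> M) c d x : smooth_map g ->
  atlas c -> atlas d -> chart_dom c x -> chart_dom d (g x) ->
  differentiable (d \o g \o chart_inv c) (c x).
Proof.
move=> [_ sg] ac ad cx dgx; have [dg _] := sg _ _ ac ad 1; apply: dg => /=.
by rewrite chart_mapK//; split=> //; exact: chart_map_cod.
Qed.

Lemma diff_chart c x w : chart_dom c x ->
  'd (c \o chart_inv c) (c x) w = w.
Proof.
move=> cx; rewrite -[RHS](_ : 'd id (c x) w = w); last by rewrite diff_val.
apply/esym/near_eq_diff => //.
apply: (@open_near_eq _ _ _ (chart_cod c)); first exact: chart_cod_open.
  exact: chart_map_cod.
by move=> a /[!inE] ca /=; rewrite chart_invK.
Qed.

(** A chart cancels its inverse only on an open set, so the composite is known only near [x]. The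
    separate [y] lets a base point be written [d (g x)], which equals [f x] only through
    [chart_mapK]. *)
Lemma diff_comp_near (U V W : normedModType R) (f : U -> V) (g : V -> W)
    (h : U -> W) (x : U) (y : V) (w : U) : f x = y ->
  differentiable f x -> differentiable g y -> {near x, g \o f =1 h} ->
  'd g y ('d f x w) = 'd h x w.
Proof.
move=> <- df dg gfh.
have dgf : differentiable (g \o f) x by exact: differentiable_comp.
by rewrite -(near_eq_diff w gfh dgf) (diff_comp df dg).
Qed.

Lemma diff_postcomp_chart (g : M -> M) c d e x w : smooth_map g ->
  atlas c -> atlas d -> atlas e ->
  chart_dom c x -> chart_dom d (g x) -> chart_dom e (g x) ->
  'd (e \o chart_inv d) (d (g x)) ('d (d \o g \o chart_inv c) (c x) w) =
  'd (e \o g \o chart_inv c) (c x) w.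
Proof.
move=> sg ac ad ae cx dgx egx.
have dg := smooth_map_differentiable sg ac ad cx dgx.
have dt := smooth_map_differentiable smooth_map_id ad ae dgx egx.
apply: diff_comp_near _ dg dt _; first by rewrite /= chart_mapK.
have oS := chart_inv_preimage_open (c := c) sg.1 (chart_dom_open d).
apply: (open_near_eq oS).
  by rewrite /= chart_mapK//; split=> //; exact: chart_map_cod.
by move=> a; rewrite inE /= => -[_ da]; rewrite chart_mapK.
Qed.

Lemma diff_precomp_chart (g : M -> M) c d e x w : smooth_map g ->
  atlas c -> atlas d -> atlas e ->
  chart_dom c x -> chart_dom e x -> chart_dom d (g x) ->
  'd (d \o g \o chart_inv e) (e x) ('d (e \o chart_inv c) (c x) w) =
  'd (d \o g \o chart_inv c) (c x) w.
Proof.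
move=> sg ac ad ae cx ex dgx.
have dg := smooth_map_differentiable sg ae ad ex dgx.
have dt := smooth_map_differentiable smooth_map_id ac ae cx ex.
apply: diff_comp_near _ dt dg _; first by rewrite /= chart_mapK.
have oS := chart_inv_preimage_open (c := c) smooth_map_id.1 (chart_dom_open e).
apply: (open_near_eq oS).
  by rewrite /= chart_mapK//; split=> //; exact: chart_map_cod.
by move=> a; rewrite inE /= => -[_ da]; rewrite chart_mapK.
Qed.

(** The differential of a transition map is injective: composed with that of the inverse transition
    it is the identity. *)
Lemma tangent_of_coord_neq0 c a w : atlas c -> chart_cod c a -> w != 0 ->
  tangent_of_coord c a w != 0.
Proof.
move=> ac ca; apply: contra_neq => w0.
set x := chart_inv c a in w0 *; pose e := chart_at x.
have cx : chart_dom c x by exact: chart_inv_dom.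
have ex : chart_dom e x by exact: mem_chart_at.
have ae : atlas e by exact: chart_at_atlas.
have {}w0 : 'd (e \o idfun \o chart_inv c) (c x) w = 0.
  have -> : c x = a by exact: chart_invK.
  exact: w0.
have E := diff_postcomp_chart w smooth_map_id ac ae ac cx ex cx.
have d0 v : v = 0 -> 'd (c \o chart_inv e) (e x) v = 0.
  by move=> ->; exact: linear0.
apply: etrans (esym (diff_chart w cx)) _.
exact: etrans (esym E) (d0 _ w0).
Qed.

End Charts.

(** * Finsler metrics as smooth families of Minkowski norms *)

Section Finsler.
Context {R : realType} {n : nat} {M : manifold R n}.
Implicit Types (F G : forall x : M, tangent x -> R) (x : M).

Lemma open_chart_neq0 (c : chart R n M) :
  open [set p : 'rV[R]_n * 'rV[R]_n | chart_cod c p.1 /\ p.2 != 0].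
Proof.
have o1 : open [set p : 'rV[R]_n * 'rV[R]_n | chart_cod c p.1].
  apply: (@open_comp _ _ fst (chart_cod c)); last exact: chart_cod_open.
  by move=> p _; exact: cvg_fst.
have o2 : open [set p : 'rV[R]_n * 'rV[R]_n | p.2 != 0].
  apply: (@open_comp _ _ snd (fun w : 'rV[R]_n => w != 0)); last exact: open_neq0.
  by move=> p _; exact: cvg_snd.
exact: openI o1 o2.
Qed.

Lemma in_chart_chart F (c : chart R n M) x w : chart_dom c x ->
  F x ('d (chart_at x \o chart_inv c) (c x) w) = in_chart F c (c x, w).
Proof. by move=> cx; rewrite /in_chart /tangent_of_coord/= chart_mapK. Qed.

Lemma in_chart_at F x w :
  F x w = in_chart F (chart_at x) (chart_at x x, w).
Proof.
by rewrite -in_chart_chart ?diff_chart//; exact: mem_chart_at.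
Qed.

Lemma in_chart_opp F (c : chart R n M) p :
  in_chart (fun x (v : tangent x) => F x (- v)) c p = in_chart F c (p.1, - p.2).
Proof. by rewrite /in_chart/= /tangent_of_coord linearN. Qed.

(** Smoothness on the fibre is smoothness of [in_chart F c] along the affine map sending [w] to
    [(c x, w)]. *)
Lemma finsler_minkowski F x : finsler_metric F ->
  minkowski_norm (F x : 'rV[R]_n -> R).
Proof.
move=> hF; split; [|exact: finsler_ge0|exact: finsler_eq0|
  exact: finsler_homogeneous|by move=> v u v0 u0; exact: finsler_posdef].
move=> k; set c := chart_at x.
have lL : linear (fun w : 'rV[R]_n => (0 : 'rV[R]_n, w)).
  by move=> a u v; apply/pair_equal_spec; rewrite /= scaler0 addr0.
pose L : {linear _ -> _} := HB.pack (fun w : 'rV[R]_n => (0 : 'rV[R]_n, w))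
  (GRing.isLinear.Build _ _ _ _ _ lL).
have cL : continuous L.
  have c0 : continuous (fun _ : 'rV[R]_n => 0 : 'rV[R]_n).
    exact: cst_continuous.
  by move=> w; exact: cvg_pair (c0 w) cvg_id.
have sF := finsler_smooth hF (chart_at_atlas x) k.
apply: C_k_ext open_neq0 _ (C_k_comp_affine (L := L) (b := (c x, 0)) open_neq0 cL _ sF).
  by move=> w _; rewrite in_chart_at /= [_ + _](_ : _ = (c x, w))//;
    apply/pair_equal_spec; rewrite /= addr0 add0r.
move=> w /= w0; rewrite /= addr0 add0r; split=> //.
exact/chart_map_cod/mem_chart_at.
Qed.

Lemma minkowski_finsler F :
  (forall x, minkowski_norm (F x : 'rV[R]_n -> R)) ->
  (forall c : chart R n M, atlas c ->
    forall p, chart_cod c p.1 -> {for p, continuous (in_chart F c)}) ->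
  (forall c : chart R n M, atlas c ->
    smooth_on [set p | chart_cod c p.1 /\ p.2 != 0] (in_chart F c)) ->
  finsler_metric F.
Proof.
move=> mF cF sF; split=> //.
- by move=> x; exact: minkowski_ge0.
- by move=> x; exact: minkowski_eq0.
- by move=> x; exact: minkowski_homogeneous.
- by move=> x v v0 u u0; exact: minkowski_posdef.
Qed.

Lemma finsler_metricD F G : finsler_metric F -> finsler_metric G ->
  finsler_metric (fun x (v : tangent x) => F x v + G x v).
Proof.
move=> hF hG; apply: minkowski_finsler.
- by move=> x; apply: minkowski_normD; exact: finsler_minkowski.
- move=> c ac p cp.
  by apply: continuousD; [exact: finsler_continuous hF _ ac _ cp|
                          exact: finsler_continuous hG _ ac _ cp].
- move=> c ac k; have sF := finsler_smooth hF ac k.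
  have sG := finsler_smooth hG ac k.
  exact: C_kD (open_chart_neq0 (c := c)) sF sG.
Qed.

Lemma finsler_metric_hypot F G : finsler_metric F -> finsler_metric G ->
  finsler_metric (fun x (v : tangent x) => Num.sqrt (F x v ^+ 2 + G x v ^+ 2)).
Proof.
move=> hF hG; apply: minkowski_finsler.
- by move=> x; apply: minkowski_norm_hypot; exact: finsler_minkowski.
- move=> c ac p cp.
  have cF := finsler_continuous hF ac cp; have cG := finsler_continuous hG ac cp.
  apply: (@continuous_comp _ _ _
    (fun p => in_chart F c p ^+ 2 + in_chart G c p ^+ 2)).
    by apply: continuousD; rewrite /GRing.exp/=; apply: continuousM.
  exact: sqrt_continuous.
- move=> c ac k.
  have sF := finsler_smooth hF ac k; have sG := finsler_smooth hG ac k.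
  have oc := open_chart_neq0 (c := c).
  apply: C_k_sqrt oc _ (C_kD oc (C_kM oc sF sF) (C_kM oc sG sG)) => -[a w] /= [ca w0].
    (* The radicand is positive here since nonzero coordinates represent a nonzero tangent
       vector. *)
    have w0' := tangent_of_coord_neq0 ac ca w0.
    have F0 := minkowski_gt0 (finsler_minkowski (chart_inv c a) hF) w0'.
    by apply: ltr_pwDl; rewrite -expr2 ?sqr_ge0// exprn_gt0.
Qed.

(** In every chart, reversal is the linear map sending [(a, w)] to [(a, - w)]. *)
Lemma finsler_metric_opp F : finsler_metric F ->
  finsler_metric (fun x (v : tangent x) => F x (- v)).
Proof.
move=> hF; have EF c : in_chart (fun x (v : tangent x) => F x (- v)) c =
    fun p => in_chart F c (p.1, - p.2).
  by apply/funext => p; rewrite in_chart_opp.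
have cp : continuous (fun p : 'rV[R]_n * 'rV[R]_n => (p.1, - p.2)).
  by move=> p; exact: cvg_pair cvg_fst (cvgN cvg_snd).
have lL : linear (fun p : 'rV[R]_n * 'rV[R]_n => (p.1, - p.2)).
  by move=> a u v; apply/pair_equal_spec; rewrite /= opprD scalerN.
pose L : {linear _ -> _} := HB.pack (fun p : 'rV[R]_n * 'rV[R]_n => (p.1, - p.2))
  (GRing.isLinear.Build _ _ _ _ _ lL).
apply: minkowski_finsler.
- by move=> x; apply: minkowski_norm_opp; exact: finsler_minkowski.
- move=> c ac p cp1; rewrite EF.
  apply: (@continuous_comp _ _ _ (fun p : 'rV[R]_n * 'rV[R]_n => (p.1, - p.2))).
    exact: cp.
  exact: finsler_continuous.
- move=> c ac k; have oc := open_chart_neq0 (c := c).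
  apply: C_k_ext oc _ (C_k_comp_affine (L := L) (b := 0) oc cp _ (finsler_smooth hF ac k)).
    by move=> p _; rewrite add0r EF.
  by move=> p /= [cp1 p2]; rewrite !add0r oppr_eq0.
Qed.

End Finsler.

(** * Semicontinuity of the differential *)

Section Semicontinuity.
Context {R : realType} {n : nat} {M : manifold R n}.
Implicit Types (F : forall x : M, tangent x -> R) (c d : chart R n M).
Implicit Types (f g : M -> M) (x : M) (a b v w : 'rV[R]_n).

(** [differential] is expressed in the charts [chart_at x] and [chart_at (g x)]; a change of chart
    at the source and another at the target lead to arbitrary [c] and [d]. *)
Lemma differential_chart F g c d x w : smooth_map g -> atlas c -> atlas d ->
  chart_dom c x -> chart_dom d (g x) ->
  F (g x) (differential g ('d (chart_at x \o chart_inv c) (c x) w : tangent x)) =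
  in_chart F d (d (g x), 'd (d \o g \o chart_inv c) (c x) w).
Proof.
move=> sg ac ad cx dgx.
have ae := chart_at_atlas x; have ex := mem_chart_at x.
have ae' := chart_at_atlas (g x); have egx := mem_chart_at (g x).
apply: etrans _ (in_chart_chart F _ dgx); apply: (congr1 (F (g x))).
have E1 := diff_precomp_chart w sg ac ae' ae cx ex egx.
have E2 := diff_postcomp_chart w sg ac ad ae' cx dgx egx.
exact: etrans E1 (esym E2).
Qed.

Lemma differential_coord F g c d a w : smooth_map g -> atlas c -> atlas d ->
  chart_cod c a -> chart_dom d (g (chart_inv c a)) ->
  F (g (chart_inv c a)) (differential g (tangent_of_coord c a w)) =
  in_chart F d (d (g (chart_inv c a)), 'd (d \o g \o chart_inv c) a w).
Proof.
move=> sg ac ad ca dg.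
have := differential_chart F w sg ac ad (chart_inv_dom ca) dg.
by rewrite chart_invK.
Qed.

Lemma differential_at F g d x (v : tangent x) : smooth_map g -> atlas d ->
  chart_dom d (g x) ->
  F (g x) (differential g v) =
  in_chart F d (d (g x), 'd (d \o g \o chart_inv (chart_at x)) (chart_at x x) v).
Proof.
move=> sg ad dgx; have cx := mem_chart_at x.
apply: etrans _ (differential_chart F v sg (chart_at_atlas x) ad cx dgx).
apply: (congr1 (fun u : tangent x => F (g x) (differential g u))).
exact: esym (diff_chart v cx).
Qed.

Lemma in_chart_homogeneous F c a w (l : R) : finsler_metric F -> 0 < l ->
  in_chart F c (a, l *: w) = l * in_chart F c (a, w).
Proof.
move=> hF l0; rewrite /in_chart /tangent_of_coord linearZ.
exact: finsler_homogeneous.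
Qed.

Lemma in_chart_gt0 F c a w : finsler_metric F -> atlas c -> chart_cod c a ->
  w != 0 -> 0 < in_chart F c (a, w).
Proof.
move=> hF ac ca w0; have w0' := tangent_of_coord_neq0 ac ca w0.
exact: (minkowski_gt0 (finsler_minkowski (chart_inv c a) hF) w0').
Qed.

Lemma compact_unit_sphere : compact [set w : 'rV[R]_n | `|w| = 1].
Proof.
apply: bounded_closed_compact.
  exists 1; split=> // r r1 w /= ->; exact: ltW.
have -> : [set w : 'rV[R]_n | `|w| = 1] =
    (fun w : 'rV[R]_n => `|w|) @^-1` [set x : R | x = 1] by [].
apply: closed_comp; first by move=> w _; exact: norm_continuous.
exact: closed_eq.
Qed.

(** On the compact unit sphere the factor [lam] makes the inequality at [b0] strict, so by
    continuity it persists uniformly for [b] near [b0]; homogeneity extends it to all [w]. *)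
Lemma support_functional_near F d b0 (l : {linear 'rV[R]_n -> R}) (lam : R) :
  finsler_metric F -> atlas d -> chart_cod d b0 -> continuous l ->
  (forall w, l w <= in_chart F d (b0, w)) -> 1 < lam ->
  \forall b \near b0, forall w, l w <= lam * in_chart F d (b, w).
Proof.
move=> hF ad db0 cl lF lam1; have lam0 : 0 < lam by exact: lt_trans lam1.
have near_sphere : \forall b \near b0,
    [set w : 'rV[R]_n | `|w| = 1] `<=` [set w | l w < lam * in_chart F d (b, w)].
  have /compact_near_coveringP sphere := compact_unit_sphere.
  apply: (sphere _ (nbhs b0) (fun b w => l w < lam * in_chart F d (b, w))) => w /= w1.
  pose h (p : 'rV[R]_n * 'rV[R]_n) : R := lam * in_chart F d (p.2, p.1) - l p.1.
  have w0 : w != 0 by rewrite -normr_gt0 w1.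
  have h0 : 0 < h (w, b0).
    rewrite /h/= subr_gt0; apply: le_lt_trans (lF w) _.
    by rewrite ltr_pMl// in_chart_gt0.
  have ch : {for (w, b0), continuous h}.
    apply: continuousB; last by apply: continuous_comp; [exact: cvg_fst|exact: cl].
    apply: continuousM; first exact: cvg_cst.
    apply: (@continuous_comp _ _ _ (fun p : 'rV[R]_n * 'rV[R]_n => (p.2, p.1))).
      exact: cvg_pair cvg_snd cvg_fst.
    exact: finsler_continuous.
  have hp : \forall p \near (w, b0), l p.1 < lam * in_chart F d (p.2, p.1).
    by apply: filterS (cvgr_gt _ ch _ h0) => p; rewrite /h subr_gt0.
  exact: hp.
have db : \forall b \near b0, chart_cod d b.
  by apply: open_nbhs_nbhs; split=> //; exact: chart_cod_open.
apply: filterS2 near_sphere db => b sb db w.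
have [->|w0] := eqVneq w 0.
  by rewrite linear0; exact: mulr_ge0 (ltW lam0) (finsler_ge0 hF _).
have nw : 0 < `|w| by rewrite normr_gt0.
have -> : w = `|w| *: (`|w|^-1 *: w) by rewrite scalerA divff ?gt_eqF// scale1r.
rewrite in_chart_homogeneous// linearZ mulrCA ler_pM2l//.
by apply/ltW/sb; rewrite /= normrZ normfV normr_id mulVf// gt_eqF.
Qed.

Lemma secant_gt (S : R -> R) (m k tau : R) (P : R -> Prop) :
  is_derive (0 : R) 1 S m -> k < m -> 0 < tau -> (\forall s \near 0, P s) ->
  exists t, [/\ 0 < t, t <= tau, forall s, 0 <= s <= t -> P s &
    t * k < S t - S 0].
Proof.
move=> [dS mS] km tau0 P0.
have kS : \forall h \near 0^', k < h^-1 *: ((S \o shift 0) (h *: 1) - S 0).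
  by apply: cvgr_gt; [exact: dS|rewrite -/('D_1 S 0) mS].
move: kS; rewrite near_withinE => kS.
have PkS : \forall h \near (0 : R), P h /\
    (h != 0 -> k < h^-1 *: ((S \o shift 0) (h *: 1) - S 0)).
  exact: filterI P0 kS.
have [r /= r0 rP] := nbhs_norm0P.1 PkS.
(* Halving [r] puts the closed interval up to this point inside the open ball of radius [r]. *)
exists (Num.min (r / 2) tau); have t0 : 0 < Num.min (r / 2) tau.
  by rewrite lt_min tau0 divr_gt0.
have tr : Num.min (r / 2) tau < r.
  by rewrite gt_min ltr_pdivrMr// ltr_pMr// ltr1n.
split => //; first by rewrite ge_min lexx orbT.
  move=> s /andP[s0 st]; have /rP[] // : `|s| < r.
  by rewrite ger0_norm// (le_lt_trans st).
set t := Num.min _ _ in t0 tr *.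
have /rP[_ /(_ (lt0r_neq0 t0))] : `|t| < r by rewrite gtr0_norm.
by rewrite /= addr0 [t *: 1]mulr1 ltr_pdivlMl.
Qed.

(** Control of [g] near a curve bounds its differential only at some point of the curve. Continuity
    along the curve carries the bound back to [x] unless the value [k] is attained, which is the
    second alternative. *)
Lemma differential_lsc F f x (v : tangent x) (k tau : R) :
  finsler_metric F -> smooth_map f -> 0 < k -> 0 < tau ->
  k < F (f x) (differential f v) ->
  exists O : set {compact-open, M -> M}, [/\ open O, O f &
    forall g, O g -> smooth_map g ->
      k < F (g x) (differential g v) \/
      exists2 s : R, 0 <= s <= tau &
        let c := chart_at x in let a := c x + s *: (v : 'rV[R]_n) in
        F (g (chart_inv c a)) (differential g (tangent_of_coord c a v)) = k].
Proof.
move=> hF sf k0 tau0 kv; pose c := chart_at x; pose d := chart_at (f x).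
have ac : atlas c by exact: chart_at_atlas.
have ad : atlas d by exact: chart_at_atlas.
have cx : chart_dom c x by exact: mem_chart_at.
have dfx : chart_dom d (f x) by exact: mem_chart_at.
pose a (s : R) : 'rV[R]_n := c x + s *: (v : 'rV[R]_n).
have a0 : a 0 = c x by rewrite /a scale0r addr0.
have ca : continuous a by exact: line_continuous.
pose H (g : M -> M) := d \o g \o chart_inv c.
pose N : 'rV[R]_n -> R := F (f x).
have mN : minkowski_norm N by exact: finsler_minkowski.
pose w0 : 'rV[R]_n := differential f v.
have kw : k < N w0 by exact: kv.
have w0n : w0 != 0.
  apply/eqP => w00; move: kw; rewrite (minkowski_eq0 mN w0).2// ltNge.
  by rewrite (ltW k0).
have dN : differentiable N w0.
  by have [dN _] := minkowski_smooth mN 1; exact: dN.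
pose l : {linear 'rV[R]_n -> R} := 'd N w0.
have cl : continuous l by exact: (diff_continuous dN).
have lw0 : l w0 = N w0 by rewrite /l -deriveE// minkowski_euler.
have lN w : l w <= in_chart F d (d (f x), w).
  rewrite -in_chart_at /l -deriveE//; exact: minkowski_fundamental.
(* [k1] leaves room on both sides: [k1 < l w0] for the secant slope, and [k1 / k > 1] for moving the
   base point. Where the support inequality holds, [k1 < l w] implies that [F] exceeds [k] at
   [w]. *)
pose k1 := (k + N w0) / 2.
have kk1 : k < k1 by rewrite /k1; lra.
have k1w : k1 < N w0 by rewrite /k1; lra.
have lam1 : 1 < k1 / k by rewrite ltr_pdivlMr// mul1r.
have : nbhs (d (f x))
    [set b | forall w, l w <= k1 / k * in_chart F d (b, w)].
  exact: support_functional_near hF ad (chart_map_cod dfx) cl lN lam1.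
rewrite nbhsE => -[B [oB Bx] Bl].
pose U := [set y | chart_dom d y /\ B (d y)].
have oU : open U by exact: chart_preimage_open.
pose S g (s : R) := l (H g (a s)).
have Hd g s : smooth_map g -> chart_cod c (a s) ->
    chart_dom d (g (chart_inv c (a s))) -> differentiable (H g) (a s).
  move=> sg cs ds.
  have := smooth_map_differentiable sg ac ad (chart_inv_dom cs) ds.
  by rewrite chart_invK.
have dS g s : smooth_map g -> chart_cod c (a s) ->
    chart_dom d (g (chart_inv c (a s))) ->
    is_derive s 1 (S g) (l ('d (H g) (a s) v)).
  by move=> sg cs ds; apply: is_derive_linear_line => //; exact: Hd.
have cc0 : chart_cod c (a 0) by rewrite a0; exact: chart_map_cod.
have fa0 : f (chart_inv c (a 0)) = f x by rewrite a0 chart_mapK.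
have dS0 : is_derive (0 : R) 1 (S f) (l w0).
  have := dS f 0 sf cc0; rewrite fa0 a0 => /(_ dfx); exact.
have nearU : \forall s \near 0,
    chart_cod c (a s) /\ U (f (chart_inv c (a s))).
  have oU' := chart_inv_preimage_open (c := c) sf.1 oU.
  apply: (line_near oU'); split => //.
  by rewrite fa0; split.
have k1l : k1 < l w0 by rewrite lw0.
have [t [t0 ttau tU tS]] := secant_gt dS0 k1l tau0 nearU.
(* Half the excess of the secant: an error below [e] at each endpoint keeps the increment above
   [t * k1]. *)
pose e := (S f t - S f 0 - t * k1) / 2.
have e0 : 0 < e by rewrite /e; lra.
pose gamma (s : R) := chart_inv c (a s).
pose K := gamma @` `[0, t].
have cK : compact K.
  apply: continuous_compact (@segment_compact _ 0 t).
  apply: continuous_in_subspaceT => s; rewrite inE/= in_itv/= => st.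
  apply: continuous_comp; first exact: ca.
  by apply: chart_inv_continuous; have [] := tU s st.
pose V1 := [set y | chart_dom d y /\ [set b | S f t - e < l b] (d y)].
pose V0 := [set y | chart_dom d y /\ [set b | l b < S f 0 + e] (d y)].
have oV1 : open V1.
  apply: chart_preimage_open; apply: (@open_comp _ _ l (fun r => S f t - e < r)).
    by move=> b _; exact: cl.
  exact: open_gt.
have oV0 : open V0.
  apply: chart_preimage_open; apply: (@open_comp _ _ l (fun r => r < S f 0 + e)).
    by move=> b _; exact: cl.
  exact: open_lt.
(* [O1] keeps the image of the whole curve where the support inequality holds; [O2] and [O3] control
   its endpoints. *)
pose O1 := [set g : {compact-open, M -> M} | g @` K `<=` U].
pose O2 := [set g : {compact-open, M -> M} | g @` [set gamma t] `<=` V1].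
pose O3 := [set g : {compact-open, M -> M} | g @` [set gamma 0] `<=` V0].
have oO : open (O1 `&` (O2 `&` O3)).
  apply: openI; first exact: compact_open_open.
  by apply: openI; apply: compact_open_open => //; exact: compact_set1.
have t01 : 0 <= t <= t by rewrite lexx ltW.
have t00 : 0 <= (0 : R) <= t by rewrite lexx ltW.
exists (O1 `&` (O2 `&` O3)); split => //.
  split; first by move=> _ [_ [s st <-] <-]; have [] := tU s st.
  split=> _ [_ -> <-]; split=> /=; try by have [_ []] := tU _ t01.
  - by rewrite ltrBlDr ltrDl.
  - by have [_ []] := tU _ t00.
  - by rewrite ltrDl.
move=> g [gK [gt g0]] sg.
have gU s : 0 <= s <= t -> U (g (gamma s)).
  by move=> st; apply: gK; exists (gamma s) => //; exists s.
have gS : t * k1 < S g t - S g 0.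
  have [_ /= g1] : V1 (g (gamma t)) by apply: gt; exists (gamma t).
  have [_ /= g2] : V0 (g (gamma 0)) by apply: g0; exists (gamma 0).
  rewrite -[l (d _)]/(S g t) in g1; rewrite -[l (d _)]/(S g 0) in g2.
  by rewrite /e in g1 g2; lra.
(* As a directional derivative, [W] has its continuity supplied by [C_k 1]. *)
pose W (s : R) := 'D_v (H g) (a s).
have WE s : 0 <= s <= t -> W s = 'd (H g) (a s) v.
  by move=> st; rewrite /W deriveE//; apply: Hd; [|have [] := tU s st|have [] := gU s st].
pose P (s : R) := in_chart F d (d (g (gamma s)), W s).
have dSg s : 0 <= s <= t -> is_derive s 1 (S g) (l (W s)).
  move=> st; have [cs _] := tU s st; have [ds _] := gU s st.
  exact: (is_derive_eq (dS g s sg cs ds) (congr1 l (esym (WE s st)))).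
(* The mean value theorem turns the increment of [S g] into a parameter where [l (W s)] exceeds
   [k1]. *)
have [||s] := @MVT R (S g) (fun s => l (W s)) 0 t t0.
- by move=> s; rewrite in_itv/= => /andP[s0 st]; apply: dSg; rewrite !ltW.
- apply: derivable_within_continuous => s; rewrite in_itv/= => st.
  by have [] := dSg s st.
rewrite in_itv/= subr0 => /andP[/ltW s0 /ltW st] Ss.
have k1s : k1 < l (W s).
  by move: gS; rewrite Ss mulrC ltr_pM2r.
have s0t : 0 <= s <= t by rewrite s0 st.
have kP : k < P s.
  have [_ Bs] := gU s s0t.
  have := lt_le_trans k1s (Bl _ Bs (W s)).
  by rewrite -mulrA ltr_pMr ?(lt_trans k0 kk1)// ltr_pdivlMl// mulr1.
have PE r : 0 <= r <= t ->
    F (g (gamma r)) (differential g (tangent_of_coord c (a r) v)) = P r.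
  move=> rt; have [cr _] := tU r rt; have [dr _] := gU r rt.
  rewrite /P (WE r rt); exact: (differential_coord F v sg ac ad cr dr).
have g0x : gamma 0 = x by rewrite /gamma a0 chart_mapK.
have P0E : F (g x) (differential g v) = P 0.
  have [dg0 _] := gU 0 t00; rewrite g0x in dg0.
  rewrite /P (WE 0 t00) a0 g0x; exact: (differential_at F v sg ad dg0).
have cP r : 0 <= r <= t -> {for r, continuous P}.
  move=> rt; have [cr _] := tU r rt; have [dr _] := gU r rt.
  have cH : {for r, continuous (fun r => d (g (gamma r)))}.
    apply: (@continuous_comp _ _ _ a (H g)); first exact: ca.
    exact/differentiable_continuous/Hd.
  have cW : {for r, continuous W}.
    apply: (@continuous_comp _ _ _ a ('D_v (H g))); first exact: ca.
    by have [_ /(_ v)] := sg.2 c d ac ad 1%N; apply; split.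
  apply: (@continuous_comp _ _ _ (fun r => (d (g (gamma r)), W r))
    (in_chart F d)); first exact: cvg_pair cH cW.
  by apply: finsler_continuous => //=; exact: chart_map_cod.
(* If [P 0] does not exceed [k], then [P] takes the value [k] between 0 and [s]. *)
have [kP0|P0k] := ltP k (P 0); first by left; rewrite P0E.
right; have [||r] := @IVT R P 0 s k s0.
- apply: continuous_in_subspaceT => r; rewrite inE/= in_itv/= => /andP[r0 rs].
  by apply: cP; rewrite r0 (le_trans rs st).
- apply/andP; split; rewrite (ge_min, le_max); apply/orP; first by left.
  by right; exact: ltW.
rewrite in_itv/= => /andP[r0 rs] Pr.
exists r; first by rewrite r0 (le_trans rs)// (le_trans st).
by rewrite -Pr -PE// r0 (le_trans rs).
Qed.

End Semicontinuity.

(** * Isometries *)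

Section Isometries.
Context {R : realType} {n : nat} {M : manifold R n}.
Implicit Types (F : forall x : M, tangent x -> R) (f g : M -> M) (x : M).

Lemma differentialN f x (v : tangent x) :
  differential f (- v) = - differential f v.
Proof. exact: linearN. Qed.

(** The choice at [v] and the one at [- v] are recorded together, so that they stay coupled. *)
Definition preserves_up_to_sign F f := forall x (v : tangent x),
  (F (f x) (differential f v) = F x v /\
   F (f x) (- differential f v) = F x (- v)) \/
  (F (f x) (differential f v) = F x (- v) /\
   F (f x) (- differential f v) = F x v).

(** Eliminating [b] turns the second equation into [(a - c) * (a - d) = 0]. *)
Lemma sum_sqr_eq (a b c d : R) : a + b = c + d ->
  a ^+ 2 + b ^+ 2 = c ^+ 2 + d ^+ 2 -> (a = c /\ b = d) \/ (a = d /\ b = c).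
Proof.
move=> abcd sabcd; have bE : b = c + d - a by lra.
have /eqP : (a - c) * (a - d) = 0.
  have : 2 * ((a - c) * (a - d)) = a ^+ 2 + (c + d - a) ^+ 2 - (c ^+ 2 + d ^+ 2).
    ring.
  by rewrite -bE sabcd subrr => /eqP; rewrite mulf_eq0 pnatr_eq0 => /eqP.
rewrite mulf_eq0 !subr_eq0 => /orP[/eqP ac|/eqP ad]; [left|right]; lra.
Qed.

Lemma Iso_preserves_up_to_sign F f : finsler_metric F ->
  Iso (fun x (v : tangent x) => F x v + F x (- v)) f ->
  Iso (fun x (v : tangent x) => Num.sqrt (F x v ^+ 2 + F x (- v) ^+ 2)) f ->
  preserves_up_to_sign F f.
Proof.
move=> hF [_ Fs] [_ Fh] x v; apply: sum_sqr_eq; first exact: Fs.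
have q0 y (u : tangent y) : 0 <= F y u ^+ 2 + F y (- u) ^+ 2.
  by rewrite addr_ge0// sqr_ge0.
by have /(congr1 (fun r => r ^+ 2)) := Fh x v; rewrite !sqr_sqrtr.
Qed.

(* [Phi] is [F] or its reverse: the two cases show that each of the two signs is
   an open condition. *)
Lemma open_same_sign F Phi f x (v : tangent x) (A : set {compact-open, M -> M}) :
  finsler_metric F -> finsler_metric Phi -> smooth_map f ->
  F x (- v) < F x v -> Phi (f x) (differential f v) = F x v ->
  (forall g, A g -> smooth_map g) ->
  (forall g, A g -> forall y (u : tangent y),
    Phi (g y) (differential g u) = F y u \/
    Phi (g y) (differential g u) = F y (- u)) ->
  exists O : set {compact-open, M -> M}, [/\ open O, O f &
    forall g, O g -> A g -> Phi (g x) (differential g v) = F x v].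
Proof.
move=> hF hPhi sf Fv fv sA AF; set k := (F x v + F x (- v)) / 2.
have Fv0 := finsler_ge0 hF (- v).
have k0 : 0 < k by rewrite divr_gt0// ltr_wpDr// (le_lt_trans Fv0).
have kv : k < F x v by rewrite ltr_pdivrMr// mulr_natr mulr2n ltrD2l.
have kNv : F x (- v) < k by rewrite ltr_pdivlMr// mulr_natr mulr2n ltrD2r.
pose c := chart_at x; have ac : atlas c by exact: chart_at_atlas.
pose a (s : R) : 'rV[R]_n := c x + s *: (v : 'rV[R]_n).
have a0 : a 0 = c x by rewrite /a scale0r addr0.
have ca : continuous a by exact: line_continuous.
have cc0 : chart_cod c (a 0) by rewrite a0; exact/chart_map_cod/mem_chart_at.
have cF (w : 'rV[R]_n) : {for 0, continuous (fun s => in_chart F c (a s, w))}.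
  apply: (@continuous_comp _ _ _ (fun s => (a s, w)) (in_chart F c)).
    have cw : continuous (fun _ : R => w) by exact: cst_continuous.
    exact: cvg_pair (ca 0) (cw 0).
  exact: finsler_continuous.
have F0 (w : tangent x) : in_chart F c (a 0, w) = F x w by rewrite a0 -in_chart_at.
have near1 : \forall s \near (0 : R), k < in_chart F c (a s, v).
  by apply: (cvgr_gt _ (cF v)); rewrite F0.
have near2 : \forall s \near (0 : R), in_chart F c (a s, - (v : 'rV[R]_n)) < k.
  by apply: (cvgr_lt _ (cF (- (v : 'rV[R]_n)))); rewrite F0.
(* On a short curve the two values allowed for an element of [A] stay on opposite sides of [k], so
   neither equals [k]. *)
have near12 : \forall s \near (0 : R),
    k < in_chart F c (a s, v) /\ in_chart F c (a s, - (v : 'rV[R]_n)) < k.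
  exact: filterI near1 near2.
have [r /= r0 rP] := nbhs_norm0P.1 near12.
have r20 : 0 < r / 2 by rewrite divr_gt0.
have kf : k < Phi (f x) (differential f v) by rewrite fv.
have [W [oO fO Og]] := differential_lsc hPhi sf k0 r20 kf.
exists W; split; [exact: oO|exact: fO|move=> g Ogg Ag].
(* A value above [k] at [v] cannot be [F x (- v)], hence is [F x v]; the remaining alternative
   contradicts the choice of the curve. *)
have [kg|[s /andP[s0 sr] /= sk]] := Og g Ogg (sA g Ag).
  have [//|gv] := AF g Ag x v.
  by move: kg; rewrite gv ltNge (ltW kNv).
have /rP/= [ks sk'] : `|s| < r.
  by rewrite ger0_norm// (le_lt_trans sr)// ltr_pdivrMr// ltr_pMr// ltr1n.
pose P := Phi (g (chart_inv c (a s))) (differential g (tangent_of_coord c (a s) v)).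
have PF : P = in_chart F c (a s, v) \/
    P = in_chart (fun y (u : tangent y) => F y (- u)) c (a s, v).
  exact: AF.
have Pk : P = k by exact: sk.
have neq (p q : R) : p < q -> p = q -> False by move=> + pq; rewrite pq ltxx.
rewrite in_chart_opp Pk /= in PF.
by exfalso; case: PF => kF; [exact: neq ks kF|exact: neq sk' (esym kF)].
Qed.

(** For fixed [v] with [F x (- v) < F x v], the maps in [A] that keep the value at [v] form a
    nonempty subset that is open and closed in [A]. *)
Lemma connected_preserves F (A : set {compact-open, M -> M}) :
  finsler_metric F -> connected A -> A idfun ->
  (forall f, A f -> smooth_map f) ->
  (forall f, A f -> preserves_up_to_sign F f) ->
  forall f, A f -> forall x (v : tangent x),
    F (f x) (differential f v) = F x v.
Proof.
move=> hF cA A1 sA AF.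
(* The opposite strict inequality reduces to this case at [- v], and in case of equality both signs
   give the same value. *)
suff lt_case x (v : tangent x) f : A f -> F x (- v) < F x v ->
    F (f x) (differential f v) = F x v.
  move=> f Af x v; have [Fv|Fv|Fv] := ltgtP (F x (- v)) (F x v).
  - exact: lt_case.
  - have Fv' : F x (- - v) < F x (- v) by rewrite opprK.
    have := lt_case x (- v) f Af Fv'; rewrite differentialN => fNv.
    by have [[//]|[fv fNv']] := AF f Af x v; rewrite fv -fNv fNv'.
  - by have [[//]|[-> _]] := AF f Af x v.
move=> Af Fv.
(* Asking for an ambient open set makes [good] open at once; within [A] it amounts to the sign
   condition at [v]. *)
pose good (Phi : forall x : M, tangent x -> R) :=
  [set g : {compact-open, M -> M} | exists O : set {compact-open, M -> M},
    [/\ open O, O g &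
      forall h, O h -> A h -> Phi (h x) (differential h v) = F x v]].
have ogood Phi : open (good Phi).
  rewrite openE => g [W [oO Og PO]].
  have nO : nbhs g W by exact: open_nbhs_nbhs.
  by apply: filterS nO => h Oh; exists W.
have Fgood g : A g -> F (g x) (differential g v) = F x v -> good F g.
  move=> Ag gv; apply: (open_same_sign hF hF (sA _ Ag) Fv gv sA).
  by move=> h Ah y u; have [[]|[]] := AF h Ah y u; [left|right].
have hFN := finsler_metric_opp hF.
have Ngood g : A g -> F (g x) (- differential g v) = F x v ->
    good (fun y (u : tangent y) => F y (- u)) g.
  move=> Ag gv; apply: (open_same_sign hF hFN (sA _ Ag) Fv gv sA).
  by move=> h Ah y u; have [[]|[]] := AF h Ah y u; [right|left].
suff BA : [set g | A g /\ F (g x) (differential g v) = F x v] = A.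
  by move: Af; rewrite -[in X in X -> _]BA => -[].
apply: cA.
- exists idfun; split=> //; congr (F x _); exact: (diff_chart v (mem_chart_at x)).
- exists (good F); first exact: ogood.
  apply/seteqP; split=> g [Ag gv]; split=> //; first exact: Fgood.
  by have [W [_ Og]] := gv; apply.
(* Relative closedness: the maps in [A] taking the other sign are exactly those that are [good] for
   the reversed metric. *)
- exists (~` good (fun y (u : tangent y) => F y (- u))).
    exact/open_closedC/ogood.
  apply/seteqP; split=> g [Ag gv]; split=> //.
    move=> [W [_ Og /(_ g Og Ag) gNv]].
    have [[_ gE]|[gE _]] := AF g Ag x v.
      by move: Fv; rewrite -gE gNv ltxx.
    by move: Fv; rewrite -gE gv ltxx.
  have [[//]|[_ gE]] := AF g Ag x v.
  by case: gv; exact: Ngood.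
Qed.

End Isometries.

Theorem corollary4p6 (R : realType) (n : nat) (M : manifold R n)
    (F : forall x : M, tangent x -> R)
    (hF : finsler_metric F) (nonrev : ~ reversible F) :
  let Ftilde := fun (x : M) (v : tangent x) => F x v + F x (- v) in
  let Fhat := fun (x : M) (v : tangent x) =>
    Num.sqrt (F x v ^+ 2 + F x (- v) ^+ 2) in
  [/\ finsler_metric Ftilde /\ reversible Ftilde,
      finsler_metric Fhat /\ reversible Fhat,
      Iso F `<=` Iso Ftilde `&` Iso Fhat &
      identity_component (Iso F) =
      identity_component (Iso Ftilde `&` Iso Fhat)].
Proof.
move=> Ftilde Fhat; have hFN := finsler_metric_opp hF.
have IsoF : Iso F `<=` Iso Ftilde `&` Iso Fhat.
  move=> f [df Ff]; split; split=> // x v; rewrite /Ftilde /Fhat.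
    by rewrite -differentialN !Ff.
  by rewrite -differentialN !Ff.
split=> //.
- split; first exact: finsler_metricD hF hFN.
  by move=> x v; rewrite /Ftilde opprK addrC.
- split; first exact: finsler_metric_hypot hF hFN.
  by move=> x v; rewrite /Fhat opprK addrC.
(* The identity component is the union of the connected subsets [A] of the group that contain the
   identity. One inclusion is monotonicity; for the other, each such [A] is shown to lie in
   [Iso F]. *)
apply/seteqP; split=> f [A [A1 AF cA] Af].
  by exists A => //; split=> //; exact: subset_trans AF IsoF.
exists A => //; split=> // g Ag; split; first by have [[]] := AF g Ag.
apply: (connected_preserves hF cA A1) => // h Ah.
  by have [[[]]] := AF h Ah.
by have [] := AF h Ah; exact: Iso_preserves_up_to_sign.
Qed.
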